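(* Definite elliptic singularities are not realized by Helmholtz waves. That is, let $k,c>0$, let $\Psi(x,y,z,t)$ be a Helmholtz wave defined near a point $(x_0,y_0,z_0,t_0)\in\mathbb{R}^3\times\mathbb{R}$, and suppose $\Psi(x_0,y_0,z_0,t_0)=0$. Then the germ of $\Psi(\cdot,\cdot,\cdot,t_0)$ at $(x_0,y_0,z_0)$ is not radially equivalent to the definite elliptic singularity $(x,y,z)\mapsto x^2+y^2+z^2+\mathrm{i}z$ at the origin.
   Context: $\mathbb{C}$ is identified with $\mathbb{R}^2$ via $u+\mathrm{i}w=(u,w)$. A Helmholtz wave for $k,c>0$ is a smooth complex valued function $\Psi(x,y,z,t)$ satisfying both $\Psi_{xx}+\Psi_{yy}+\Psi_{zz}+k^2\Psi=0$ and $\Psi_{tt}=c^2(\Psi_{xx}+\Psi_{yy}+\Psi_{zz})$. A radial transformation near $0\in\mathbb{C}$ is a local diffeomorphism $\tau:(\mathbb{C},0)\to(\mathbb{C},0)$, $\tau(u,w)=(U,W)$, sending each radial line (ray) $\{\theta=\mathrm{const.}\}$ to a radial line, where $u+\mathrm{i}w=re^{\mathrm{i}\theta}$; equivalently $U=\rho(u,w)(au+bw)$, $W=\rho(u,w)(cu+dw)$ with $\rho$ a positive function and $a,b,c,d\in\mathbb{R}$, $ad-bc\neq0$. Two germs $\psi:(\mathbb{R}^3,p)\to(\mathbb{C},0)$ and $\varphi:(\mathbb{R}^3,q)\to(\mathbb{C},0)$ are radially equivalent if $\psi\circ\sigma=\tau\circ\varphi$ for some local diffeomorphism $\sigma:(\mathbb{R}^3,q)\to(\mathbb{R}^3,p)$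 and some local radial transformation $\tau$. *)

(* Defs.v *)
From HB Require Import structures.
From mathcomp Require Import all_boot all_order all_algebra.
From mathcomp Require Import all_classical all_reals all_analysis.
Import Order.TTheory GRing.Theory Num.Theory.
Import numFieldNormedType.Exports.

Set Implicit Arguments.
Unset Strict Implicit.
Unset Printing Implicit Defensive.

Local Open Scope classical_set_scope.
Local Open Scope ring_scope.

Fixpoint Cn_on (R : realType) (V W : normedModType R) (n : nat) (A : set V)
    (f : V -> W) : Prop :=
  match n with
  | 0 => forall x, A x -> {for x, continuous f}
  | m.+1 => (forall x, A x -> differentiable f x) /\
            (forall v : V, Cn_on m A ('D_v f))
  end.

(* Only meaningful for [A] open: the derivatives are those of the ambient
   space, not derivatives within [A]. *)
Definition smooth_on (R : realType) (V W : normedModType R) (A : set V)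
    (f : V -> W) : Prop :=
  forall n, Cn_on n A f.

Definition local_diffeo (R : realType) (V W : normedModType R)
    (f : V -> W) (q : V) (p : W) : Prop :=
  f q = p /\
  exists (A : set V) (B : set W) (g : W -> V),
    [/\ open A /\ A q,
        open B /\ set_bij A B f,
        (forall x, A x -> g (f x) = x),
        smooth_on A f
      & smooth_on B g].

(* The complex number u + i w is the pair (u, w) : R * R. *)
Definition ray (R : realType) (theta : R) : set (R * R)%type :=
  [set (r * cos theta, r * sin theta) | r in [set r : R | 0 <= r]].

Definition radial_transformation (R : realType) (tau : R * R -> R * R) : Prop :=
  local_diffeo tau 0 0 /\
  exists N : set (R * R)%type, nbhs (0 : R * R) N /\
    forall theta, exists theta', tau @` (N `&` ray theta) `<=` ray theta'.

(* Maps stand for their germs: only the values of [psi] near [p] and of [phi]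
   near [q] matter. *)
Definition radially_equivalent (R : realType)
    (psi : 'rV[R]_3 -> R * R) (p : 'rV[R]_3)
    (phi : 'rV[R]_3 -> R * R) (q : 'rV[R]_3) : Prop :=
  exists (sigma : 'rV[R]_3 -> 'rV[R]_3) (tau : R * R -> R * R),
    [/\ local_diffeo sigma q p,
        radial_transformation tau
      & \forall x \near q, psi (sigma x) = tau (phi x)].

Definition space_dir (R : realType) (i : 'I_3) : 'rV[R]_3 * R :=
  (delta_mx 0 i, 0).

Definition time_dir (R : realType) : 'rV[R]_3 * R := (0, 1).

Definition space_laplacian (R : realType) (Psi : 'rV[R]_3 * R -> R * R)
    (P : 'rV[R]_3 * R) : R * R :=
  \sum_(i < 3) 'D_(space_dir R i) ('D_(space_dir R i) Psi) P.

Definition helmholtz_wave_on (R : realType) (k c : R)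
    (A : set ('rV[R]_3 * R)%type) (Psi : 'rV[R]_3 * R -> R * R) : Prop :=
  [/\ smooth_on A Psi,
      (forall P, A P -> space_laplacian Psi P + k ^+ 2 *: Psi P = 0)
    & (forall P, A P -> 'D_(time_dir R) ('D_(time_dir R) Psi) P
                        = c ^+ 2 *: space_laplacian Psi P)].

Definition definite_elliptic (R : realType) (v : 'rV[R]_3) : R * R :=
  (v 0 0 ^+ 2 + v 0 1 ^+ 2 + v 0 2 ^+ 2, v 0 2).

(* Main.v *)
Require Import Defs.
From mathcomp Require Import all_boot all_order all_algebra.
From mathcomp Require Import all_classical all_reals all_analysis.
From mathcomp Require Import ring lra.
Import Order.TTheory GRing.Theory Num.Theory.
Import numFieldNormedType.Exports.
Local Open Scope classical_set_scope.
Local Open Scope ring_scope.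

(** The definite elliptic map is [phi v = (|v|^2, z)], where [z] is the last
    coordinate of [v]; it takes its values in the half-plane [0 <= u].
    A radial transformation [tau] bends this half-plane only along rays: [tau]
    sends a ray to a ray, whose direction has to be that of the image of the
    first ray by the differential [L] of [tau] at [0], so [tau w = s (L w)] for
    a scalar [s] depending on [w], and [s] is close to [1] near the origin.
    Hence the linear form [ell], first component of the
    inverse of [L], satisfies [ell (tau w) = s w.1 >= w.1 / 2] for [w] near the
    origin in the half-plane (lemma [radial_functional]).

    Suppose that [psi \o sigma = tau \o phi] for a local diffeomorphism
    [sigma].  Then [ell (psi (sigma v)) >= |v|^2 / 2], and since [sigma] is
    Lipschitz at [0], the real function [ell \o psi] grows at least like
    a positive multiple of [|y - p|^2] around the zero [p] of [psi]
    (lemma [definite_elliptic_coercive]).  All its second directional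
    derivatives at [p] are therefore positive
    (lemma [second_directional_derivative_gt0]), and so is its Laplacian.  But
    [ell] is linear, so for a Helmholtz wave this Laplacian is
    [- k^2 (ell (psi p)) = 0]. *)

(** * Calculus at a point *)

Lemma differentiable_approx {R : realType} {V W : normedModType R}
    {f : V -> W} {x : V} {e : R} :
  differentiable f x -> 0 < e ->
  \forall h \near 0, `|f (h + x) - f x - 'd f x h| <= e * `|h|.
Proof.
move=> /diff_locally /eqaddoP /(_ e) H e0.
apply: filterS (H e0) => h /=.
by rewrite opprD addrA.
Qed.

(** Quadratic growth of [f] forces [f''(0) > 0]: the derivative [f1] vanishes at
    the minimum [0], so if [a <= 0] then [f1 c <= m / 2 * c] for small [c > 0],
    and the mean value theorem bounds [f t] by [m / 2 * t^2]. *)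
Lemma second_derivative_gt0 {R : realType} {f f1 : R -> R} {a m : R} :
  0 < m -> f 0 = 0 ->
  (\forall t \near (0 : R), is_derive (t : R) 1 f (f1 t)) -> is_derive (0 : R) 1 f1 a ->
  (\forall t \near (0 : R), m * t ^+ 2 <= f t) ->
  0 < a.
Proof.
move=> m0 f0 df df1 fm.
rewrite ltNge; apply/negP => a0.
have m20 : 0 < m / 2 by rewrite divr_gt0.
have dif1 : differentiable f1 0 by apply/derivable1_diffP.
have f1E h : 'd f1 0 h = a * h.
  rewrite -[in LHS](mulr1 h) -[h * 1]/(h *: 1 : R) linearZ /= -deriveE//.
  by rewrite derive_val [RHS]mulrC.
(* The slope [m / 2] is strictly below [m], which is what the growth contradicts. *)
have apx := differentiable_approx dif1 m20.
have : \forall t \near (0 : R), is_derive (t : R) 1 f (f1 t) /\ m * t ^+ 2 <= f t /\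
   `|f1 (t + 0) - f1 0 - 'd f1 0 t| <= m / 2 * `|t|.
  by near=> t; split; [|split]; near: t.
move=> /nbhs_ballP[d /= d0 H].
have inb t : t \in `]-d, d[%R -> ball (0 : R) d t.
  by rewrite in_itv /= /ball /= sub0r normrN ltr_norml.
have f10 : f1 0 = 0.
  have D0 : is_derive (0 : R) 1 f 0.
    apply: (@derive1_at_min _ _ (- d) d).
    - by rewrite ltW// gtrN.
    - by move=> t /inb /H[[]].
    - by rewrite in_itv /= oppr_lt0 d0.
    move=> t /inb /H[_ [+ _]]; rewrite f0; apply: le_trans.
    by rewrite mulr_ge0 ?sqr_ge0// ltW.
  have [H0 _] : is_derive (0 : R) 1 f (f1 0) /\ _ := H 0 (ballxx 0 d0).
  by rewrite -(@derive_val _ _ _ _ _ _ _ H0) (@derive_val _ _ _ _ _ _ _ D0).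
pose t := d / 2.
have t0 : 0 < t by rewrite divr_gt0.
have td : t < d by rewrite /t; lra.
have sub x : 0 <= x <= t -> x \in `]-d, d[%R.
  by move=> /andP[x0 xt]; rewrite in_itv /=; apply/andP; split; lra.
have [c] : exists2 c, c \in `]0, t[%R & f t - f 0 = f1 c * (t - 0).
  apply: MVT => //.
    move=> x; rewrite in_itv /= => /andP[x0 xt].
    by have /inb /H[] : x \in `]-d, d[%R by apply: sub; rewrite !ltW.
  apply: derivable_within_continuous => x; rewrite in_itv /= => xt.
  by have /inb /H[[]] := sub x xt.
rewrite in_itv /= => /andP[c0 ct].
have [|_ [_]] := H c _; first by apply/inb/sub; rewrite !ltW.
rewrite f10 addr0 f1E subr0 (gtr0_norm c0) => /(le_trans (ler_norm _)) f1c.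
have [|_ [+ _]] := H t _; first by apply/inb/sub; rewrite lexx ltW.
rewrite f0 !subr0 => + ft; rewrite ft.
apply/negP; rewrite -ltNge expr2 mulrA ltr_pM2r//.
have : a * c <= 0 by rewrite mulr_le0_ge0// ltW.
have : m / 2 * c <= m / 2 * t by rewrite ler_pM2l// ltW.
nra.
Unshelve. all: by end_near. Qed.

Lemma cvg_line {R : realType} {V : normedModType R} (x v : V) :
  t *: v + x @[t --> (0 : R)] --> x.
Proof.
rewrite -[X in _ --> X]add0r -(scale0r v).
by apply: cvgD; [apply: cvgZr_tmp; exact: cvg_id|exact: cvg_cst].
Qed.

(** Reduces directional derivatives to ordinary derivatives of a real function,
    to which [second_derivative_gt0] applies. *)
Lemma is_derive_along_line {R : realType} {V W : normedModType R}
    {f : V -> W} {ell : {linear W -> R}} {x v : V} {t : R} :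
  continuous ell -> differentiable f (t *: v + x) ->
  is_derive (t : R) 1 (fun s : R => ell (f (s *: v + x))) (ell ('D_v f (t *: v + x))).
Proof.
move=> cell df.
have dl : is_diff t (fun s : R => s *: v + x) ( *:%R^~ v).
  by apply: is_diff_eq; rewrite addr0.
have dF : is_diff t (ell \o (f \o (fun s : R => s *: v + x)))
    (ell \o ('d f (t *: v + x) \o *:%R^~ v)).
  apply: is_diff_comp; last by split; [exact: linear_differentiable|rewrite diff_lin].
  by apply: is_diff_comp; exact: differentiableP.
split; first by apply: diff_derivable.
by rewrite deriveE// diff_val /= scale1r -deriveE.
Qed.

(** The growth hypothesis is put on a single line because, for a wave in space
    and time, growth is known on the slice of fixed time only. *)
Lemma second_directional_derivative_gt0 {R : realType} {V W : normedModType R}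
    {f : V -> W} {ell : {linear W -> R}} {x v : V} {m : R} :
  continuous ell -> (\forall y \near x, differentiable f y) ->
  differentiable ('D_v f) x -> ell (f x) = 0 -> 0 < m ->
  (\forall t \near (0 : R), m * t ^+ 2 <= ell (f (t *: v + x))) ->
  0 < ell ('D_v ('D_v f) x).
Proof.
move=> cell df ddf fx0 m0 coer.
have line := cvg_line x v.
apply: (@second_derivative_gt0 R (fun t => ell (f (t *: v + x)))
  (fun t => ell ('D_v f (t *: v + x))) _ m) => //.
- by rewrite scale0r add0r.
- near=> t.
  have dft : differentiable f (t *: v + x) by near: t; exact: (line _ df).
  exact: (is_derive_along_line cell dft).
- rewrite -[in X in ell ('D_v _ X)](add0r x) -(scale0r v).
  by apply: is_derive_along_line; rewrite // scale0r add0r.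
Unshelve. all: by end_near. Qed.

(** * First-order behaviour of local diffeomorphisms *)

(** The chain rule applied to [g \o f], which has the same germ as the
    identity. *)
Lemma diff_left_inverse {R : realType} {V W : normedModType R}
    {f : V -> W} {g : W -> V} {x : V} (v : V) :
  differentiable f x -> differentiable g (f x) ->
  (\forall y \near x, g (f y) = y) ->
  'd g (f x) ('d f x v) = v.
Proof.
move=> df dg gf.
transitivity ('d (g \o f) x v); first by rewrite (diff_comp df dg).
rewrite -deriveE; last by apply: differentiable_comp.
have -> : 'D_v (g \o f) x = 'D_v id x by apply: near_eq_derive; exact: gf.
by rewrite derive_id.
Qed.

(** The first-order content of a local diffeomorphism, in the form in which the
    growth estimates use it. *)
Lemma local_diffeo_inverse {R : realType} {V W : normedModType R}
    {f : V -> W} {q : V} {p : W} :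
  local_diffeo f q p ->
  exists g : W -> V,
    [/\ f q = p /\ g p = q, differentiable f q, differentiable g p,
        \forall x \near q, g (f x) = x & \forall y \near p, f (g y) = y].
Proof.
move=> [fq [A [B [g [[oA Aq] [oB bij] gf sf sg]]]]].
have [fun_ _ surj] := bij.
have Bp : B p by rewrite -fq; apply: fun_.
exists g; split.
- by rewrite -{2}fq gf.
- by have [+ _] := sf 1%N; exact.
- by have [+ _] := sg 1%N; exact.
- by apply: filterS (open_nbhs_nbhs (conj oA Aq)) => x /gf.
- apply: filterS (open_nbhs_nbhs (conj oB Bp)) => y /surj[x Ax <-].
  by rewrite gf.
Qed.

(** A map differentiable at [q] is Lipschitz at [q]; applied at [g y], this
    bounds the distance to [p] by the distance of the preimage to [q]. *)
Lemma local_diffeo_dominates {R : realType} {V W : normedModType R}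
    {f : V -> W} {q : V} {p : W} :
  local_diffeo f q p ->
  exists g : W -> V, exists2 K : R, 0 < K &
    [/\ g y @[y --> p] --> q, \forall y \near p, f (g y) = y
      & \forall y \near p, `|y - p| <= K * `|g y - q|].
Proof.
move=> /local_diffeo_inverse [g [[fq gp] df dg _ fg]].
have [k k0 dfk] := linear_lipschitz (diff_continuous df).
have cg : g y @[y --> p] --> q by rewrite -gp; exact: differentiable_continuous.
exists g, (1 + k); first by rewrite addr_gt0.
split => //.
have apx : \forall x \near q, `|f x - p - 'd f q (x - q)| <= 1 * `|x - q|.
  have := differentiable_approx df ltr01.
  rewrite (near_shift q) /= sub0r.
  by apply: filterS => x; rewrite /= subrK fq.
have apxg : \forall y \near p,
    `|f (g y) - p - 'd f q (g y - q)| <= 1 * `|g y - q|.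
  exact: (cg _ apx).
near=> y.
have fgy : f (g y) = y by near: y.
have ay : `|f (g y) - p - 'd f q (g y - q)| <= 1 * `|g y - q| by near: y.
rewrite -{1}fgy -[_ - p](subrK ('d f q (g y - q))).
by rewrite (le_trans (ler_normD _ _))// mulrDl lerD.
Unshelve. all: by end_near. Qed.

(** * Radial transformations of the plane *)

Lemma polar_coordinates {R : realType} (z : R * R) :
  exists r theta : R, 0 <= r /\ z = (r * cos theta, r * sin theta).
Proof.
case: z => x y; pose r := Num.sqrt (x ^+ 2 + y ^+ 2).
have r0 : 0 <= r by exact: sqrtr_ge0.
have r2 : r ^+ 2 = x ^+ 2 + y ^+ 2 by rewrite sqr_sqrtr// addr_ge0 ?sqr_ge0.
have [rE|rn0] := eqVneq r 0.
  exists 0, 0; split=> //; rewrite !mul0r.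
  move: r2; rewrite rE expr0n /= => /esym/eqP.
  by rewrite paddr_eq0 ?sqr_ge0// !sqrf_eq0 => /andP[/eqP -> /eqP ->].
have rp : 0 < r by rewrite lt_neqAle eq_sym rn0.
have xr : -1 <= x / r <= 1.
  rewrite ler_pdivlMr// ler_pdivrMr// mulN1r mul1r -ler_norml.
  rewrite -(ler_pXn2r (n:=2)) ?nnegrE// real_normK ?num_real// r2.
  by rewrite lerDl sqr_ge0.
have cE : cos (acos (x / r)) = x / r by rewrite acosK// in_itv.
have sE : r * sin (acos (x / r)) = `|y|.
  rewrite sin_acos// -[X in X * _]ger0_norm// -sqrtr_sqr -sqrtrM ?sqr_ge0//.
  rewrite -[RHS]sqrtr_sqr; congr Num.sqrt.
  rewrite mulrBr mulr1 expr_div_n mulrCA divff ?sqrf_eq0// mulr1 r2.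
  by rewrite addrAC subrr add0r.
have rc : r * cos (acos (x / r)) = x by rewrite cE mulrCA divff// mulr1.
have [y0|y0] := leP 0 y.
  by exists r, (acos (x / r)); split=> //; rewrite rc sE ger0_norm.
by exists r, (- acos (x / r)); split=> //; rewrite cosN sinN mulrN rc sE ltr0_norm// opprK.
Qed.

(** Passing from the ray to its line forgets the sign of the scalar [s] with
    [tau z = s (L z)]; [radial_functional] recovers it from [s] being close to
    [1]. *)
Lemma ray_collinear {R : realType} {theta : R} {w : R * R} :
  ray theta w -> w.1 * sin theta - w.2 * cos theta = 0.
Proof. by move=> [r _ <-] /=; ring. Qed.

Lemma collinear_scale {R : realType} {theta : R} {w : R * R} :
  w.1 * sin theta - w.2 * cos theta = 0 ->
  exists a, w = a *: ((cos theta, sin theta) : (R * R)%type).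
Proof.
case: w => x y /= /eqP; rewrite subr_eq0 => /eqP xy.
have cs := cos2Dsin2 theta.
have xE : x = (x * cos theta + y * sin theta) * cos theta.
  transitivity (x * cos theta ^+ 2 + x * sin theta * sin theta); last first.
    by rewrite xy; ring.
  by rewrite -mulrA -expr2 -mulrDr cs mulr1.
have yE : y = (x * cos theta + y * sin theta) * sin theta.
  transitivity (y * cos theta * cos theta + y * sin theta ^+ 2); last first.
    by rewrite -xy; ring.
  by rewrite -mulrA -expr2 -mulrDr cs mulr1.
by exists (x * cos theta + y * sin theta); exact: (congr2 pair xE yE).
Qed.

(** [tau (h *: z) / h] stays in the closed line carrying the ray and converges to
    the differential at [z] when [h] tends to [0] from the right. *)
Lemma collinear_diff {R : realType} {tau : R * R -> R * R} {z : R * R}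
    {theta : R} :
  differentiable tau 0 -> tau 0 = 0 ->
  (\forall h \near 0^'+, ray theta (tau (h *: z))) ->
  ('d tau 0 z).1 * sin theta - ('d tau 0 z).2 * cos theta = 0.
Proof.
move=> dtau tau0 rz; rewrite -deriveE//.
have lim_quot : h^-1 *: tau (h *: z) @[h --> 0^'+] --> 'D_z tau 0.
  have := @diff_derivable _ _ _ tau 0 z dtau.
  rewrite /derivable -/('D_z tau 0) => /cvg_dnbhs_at_right.
  by under eq_fun do rewrite /= tau0 addr0 subr0.
pose n (w : R * R) := w.1 * sin theta - w.2 * cos theta.
have ncont : continuous n.
  move=> w; apply: cvgB; apply: cvgM; try exact: cvg_cst.
    exact: cvg_fst.
  exact: cvg_snd.
have cn : n (h^-1 *: tau (h *: z)) @[h --> 0^'+] --> n ('D_z tau 0).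
  exact: cvg_comp lim_quot (ncont _).
have c0 : n (h^-1 *: tau (h *: z)) @[h --> 0^'+] --> (0 : R).
  apply: cvg_near_cst; near=> h.
  have /ray_collinear e : ray theta (tau (h *: z)) by near: h.
  by rewrite /n /GRing.scale /= -!mulrA -mulrBr e mulr0.
exact: cvg_unique cn c0.
Unshelve. all: by end_near. Qed.

(** [tau z] and [L z], for [L] the differential of [tau] at [0], lie on the line
    of the same target ray, hence [tau z = s (L z)].  Applying [M], the inverse
    of [L], gives [M (tau z) = s z]; as this is [z] up to an error of at most
    [|z| / 2], the scalar satisfies [s >= 1 / 2], and [ell] can be the first
    component of [M]. *)
Lemma radial_functional {R : realType} {tau : R * R -> R * R} :
  radial_transformation tau ->
  exists ell : {linear (R * R)%type -> R}, continuous ell /\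
    \forall z \near (0 : (R * R)%type), 0 <= z.1 -> z.1 / 2 <= ell (tau z).
Proof.
move=> [/local_diffeo_inverse [g [[tau0 _] dtau dg gtau _]] [N [N0 rayN]]].
pose M : {linear _ -> _} := 'd g 0; pose L : {linear _ -> _} := 'd tau 0.
have ML z : M (L z) = z.
  by have := diff_left_inverse z dtau; rewrite tau0 => /(_ _ dg gtau).
have [K K0] := linear_lipschitz (diff_continuous dg).
rewrite -/M => MK.
(* [M] multiplies errors by at most [K], so this tolerance becomes [1 / 2]. *)
have e0 : 0 < (2 * K)^-1 by rewrite invr_gt0 mulr_gt0.
have := differentiable_approx dtau e0; rewrite -/L => apx.
have cM : continuous M := diff_continuous dg.
have colD w theta : (\forall h \near 0^'+, ray theta (tau (h *: w))) ->
    (L w).1 * sin theta - (L w).2 * cos theta = 0.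
  exact: collinear_diff.
(* From here on [M] and [L] are arbitrary linear maps with these properties. *)
move: (M) (L) ML MK apx cM colD => {}M {}L ML MK apx cM colD.
pose ell : {linear (R * R)%type -> R} := fst \o M.
exists ell; split.
  move=> w; apply: (@continuous_comp _ _ _ M fst).
    exact: cM.
  exact: cvg_fst.
have [d /= d0 Nd] := (nbhs_ballP _ _).1 N0.
near=> z; rewrite /= => z1.
have bz : ball (0 : R * R) d z by near: z; exact: nbhsx_ballx.
have az : `|tau z - L z| <= (2 * K)^-1 * `|z|.
  by near: z; apply: filterS apx => z; rewrite tau0 addr0 subr0.
have [->|zn0] := eqVneq z 0; first by rewrite tau0 /= mul0r (linear0 M).
have [r [theta [r0 zE]]] := polar_coordinates z.
have [theta' img] := rayN theta.
have zray h : 0 < h <= 1 -> ray theta' (tau (h *: z)).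
  move=> /andP[h0 h1]; apply: img; exists (h *: z) => //; split.
    apply: Nd; rewrite -ball_normE /= sub0r normrN normrZ gtr0_norm//.
    move: bz; rewrite -ball_normE /= sub0r normrN; apply: le_lt_trans.
    by rewrite ler_piMl.
  exists (h * r); first by rewrite /= mulr_ge0// ltW.
  by rewrite zE; apply: (congr2 pair); rewrite -mulrA.
have colL : (L z).1 * sin theta' - (L z).2 * cos theta' = 0.
  apply: colD; near=> h; apply: zray; apply/andP; split.
    by near: h; exact: nbhs_right_gt.
  by near: h; apply: nbhs_right_le; exact: ltr01.
have colT : (tau z).1 * sin theta' - (tau z).2 * cos theta' = 0.
  by apply: ray_collinear; rewrite -[z]scale1r; apply: zray; rewrite ltr01 lexx.
have [b Lz] := collinear_scale colL.
have [a Tz] := collinear_scale colT.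
have bn0 : b != 0.
  apply: contra_neq zn0 => b0.
  by rewrite -(ML z) Lz b0 scale0r linear0.
have MT : M (tau z) = (a / b) *: z.
  by rewrite -[in RHS](ML z) Lz Tz 2!(linearZZ M) scalerA divfK.
rewrite MT.
have : `|(a / b - 1) *: z| <= 2^-1 * `|z|.
  rewrite scalerBl scale1r -MT -[in X in _ - X](ML z) -linearB.
  apply: le_trans (MK _) _; rewrite -ler_pdivlMl//.
  by rewrite mulrA -invfM [K * 2]mulrC.
rewrite normrZ ler_pM2r ?normr_gt0// => /ler_normlP[ab _].
rewrite /GRing.scale /= mulrC ler_wpM2r//.
by lra.
Unshelve. all: by end_near. Qed.

(** * Growth of maps with a definite elliptic zero *)

Lemma norm_coord_le {R : realType} {m n : nat} (v : 'M[R]_(m, n)) i j :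
  `|v i j| <= `|v|.
Proof.
rewrite [leRHS]mx_normrE.
by rewrite (bigmax_sup (i, j)).
Qed.

(** The norm on row vectors is the sup norm, so this compares it with the
    Euclidean one. *)
Lemma norm_sqr_le_definite_elliptic {R : realType} (v : 'rV[R]_3) :
  `|v| ^+ 2 <= (definite_elliptic v).1.
Proof.
have [v0|] := eqVneq `|v| 0.
  by rewrite v0 expr0n /= !addr_ge0// sqr_ge0.
move=> /mx_norm_neq0[[i j] vE]; have -> : `|v| = `|v i j| := vE.
rewrite real_normK ?num_real// (ord1 i) /definite_elliptic /=.
have := (sqr_ge0 (v 0 0), sqr_ge0 (v 0 1), sqr_ge0 (v 0 2)).
case: j {vE} => [[|[|[|//]]] p] [[h0 h1] h2].
- by rewrite (_ : Ordinal p = 0)//; [lra|exact: val_inj].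
- by rewrite (_ : Ordinal p = 1)//; [lra|exact: val_inj].
- by rewrite (_ : Ordinal p = 2)//; [lra|exact: val_inj].
Qed.

Lemma definite_elliptic0 {R : realType} : definite_elliptic (0 : 'rV[R]_3) = 0.
Proof. by rewrite /definite_elliptic !mxE expr0n /= !addr0. Qed.

Lemma definite_elliptic_continuous {R : realType} :
  continuous (@definite_elliptic R).
Proof.
move=> v.
have cc j : (w : 'rV[R]_3) 0 j @[w --> v] --> v 0 j by exact: coord_continuous.
have c2 j : (w : 'rV[R]_3) 0 j ^+ 2 @[w --> v] --> v 0 j ^+ 2.
  by rewrite expr2; under eq_fun do rewrite expr2; exact: cvgM (cc j) (cc j).
exact: cvg_pair (cvgD (cvgD (c2 0) (c2 1)) (c2 2)) (cc 2).
Qed.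

(** Transports the lower bound of [radial_functional] through [sigma]: with
    [v = g y] the preimage of [y], [ell (psi y) = ell (tau (phi v))] is at least
    [|v|^2 / 2], and [|y - p| <= K |v|]. *)
Lemma definite_elliptic_coercive {R : realType} {psi : 'rV[R]_3 -> R * R}
    {p : 'rV[R]_3} :
  radially_equivalent psi p (@definite_elliptic R) 0 ->
  exists ell : {linear (R * R)%type -> R}, continuous ell /\
    exists2 m : R, 0 < m &
      \forall y \near p, m * `|y - p| ^+ 2 <= ell (psi y).
Proof.
move=> [sigma [tau [dsigma rtau eqv]]].
have [ell [cell ltau]] := radial_functional rtau.
have [g [K K0 [cg sg dom]]] := local_diffeo_dominates dsigma.
(* The witness comes from [|v|^2 / 2 >= (|y - p| / K)^2 / 2]. *)
exists ell; split => //; exists (2 * K ^+ 2)^-1.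
  by rewrite invr_gt0 mulr_gt0// exprn_gt0.
have celliptic : definite_elliptic v @[v --> (0 : 'rV[R]_3)] --> (0 : (R * R)%type).
  have := definite_elliptic_continuous (0 : 'rV[R]_3).
  by rewrite /continuous_at definite_elliptic0.
have lphi : \forall v \near (0 : 'rV[R]_3), 0 <= (definite_elliptic v).1 ->
    (definite_elliptic v).1 / 2 <= ell (tau (definite_elliptic v)).
  exact: (celliptic _ ltau).
have eqvg : \forall y \near p,
    psi (sigma (g y)) = tau (definite_elliptic (g y)).
  exact: (cg _ eqv).
have lphig : \forall y \near p, 0 <= (definite_elliptic (g y)).1 ->
    (definite_elliptic (g y)).1 / 2 <= ell (tau (definite_elliptic (g y))).
  exact: (cg _ lphi).
near=> y.
have sgy : sigma (g y) = y by near: y.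
have domy : `|y - p| <= K * `|g y - 0| by near: y.
have eqy : psi (sigma (g y)) = tau (definite_elliptic (g y)) by near: y.
have le : 0 <= (definite_elliptic (g y)).1 ->
  (definite_elliptic (g y)).1 / 2 <= ell (tau (definite_elliptic (g y))).
  by near: y.
have gg := norm_sqr_le_definite_elliptic (g y).
rewrite -{2}sgy eqy (le_trans _ (le _))//; last exact: le_trans (sqr_ge0 _) gg.
rewrite mulrC ler_pdivrMr ?mulr_gt0 ?exprn_gt0//.
rewrite mulrA divfK ?pnatr_eq0//.
apply: le_trans (_ : `|g y| ^+ 2 * K ^+ 2 <= _); last by rewrite ler_wpM2r// sqr_ge0.
rewrite -exprMn mulrC ler_pXn2r ?nnegrE// ?mulr_ge0// ?(ltW K0)//.
by rewrite subr0 in domy.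
Unshelve. all: by end_near. Qed.

(** * Helmholtz waves *)

Theorem proposition4p4 (R : realType) (k c : R) (hk : 0 < k) (hc : 0 < c)
    (A : set ('rV[R]_3 * R)%type) (Psi : 'rV[R]_3 * R -> R * R)
    (p0 : 'rV[R]_3) (t0 : R)
    (hA : open A) (hp0 : A (p0, t0))
    (hPsi : helmholtz_wave_on k c A Psi)
    (hzero : Psi (p0, t0) = 0) :
  ~ radially_equivalent (fun p => Psi (p, t0)) p0 (@definite_elliptic R) 0.
Proof.
move=> /definite_elliptic_coercive [ell [cell [m m0 coer]]].
have [smooth helmholtz _] := hPsi.
have := helmholtz _ hp0; rewrite hzero scaler0 addr0 => lap0.
have dPsi P : A P -> differentiable Psi P by have [+ _] := smooth 1%N; exact.
have dDPsi v P : A P -> differentiable ('D_v Psi) P.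
  by have [_ /(_ v)[+ _]] := smooth 2%N; exact.
have pos i : 0 < ell ('D_(space_dir R i) ('D_(space_dir R i) Psi) (p0, t0)).
  apply: (second_directional_derivative_gt0 cell _ _ _ m0).
  - by apply: filterS (open_nbhs_nbhs (conj hA hp0)) => P; exact: dPsi.
  - exact: dDPsi.
  - by rewrite hzero linear0.
  have line := cvg_line p0 (delta_mx 0 i).
  near=> t.
  have : m * `|t *: delta_mx 0 i + p0 - p0| ^+ 2
      <= ell (Psi (t *: delta_mx 0 i + p0, t0)).
    by near: t; exact: (line _ coer).
  have -> : t *: space_dir R i + (p0, t0) = (t *: delta_mx 0 i + p0, t0).
    by apply: (congr2 pair); rewrite //= scaler0 add0r.
  apply: le_trans; rewrite addrK ler_wpM2l ?(ltW m0)//.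
  rewrite -(real_normK (num_real t)) ler_pXn2r ?nnegrE//.
  apply: le_trans (norm_coord_le _ 0 i).
  by rewrite !mxE !eqxx mulr1.
have : 0 < ell (space_laplacian Psi (p0, t0)).
  rewrite /space_laplacian linear_sum /= big_ord_recl.
  rewrite ltr_wpDr// sumr_ge0// => i _; exact: ltW.
by rewrite lap0 linear0 ltxx.
Unshelve. all: by end_near. Qed.
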